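(* Let $\tilde G=(\tilde V,\tilde b,\tilde m)$ be a model graph and let $G=(V,b,m)$ be a graph. 1) If $G$ has weaker curvature growth than $\tilde G$ and $\tilde G$ is $L^1$-Liouville, then $G$ is $L^1$-Liouville. 2) If $G$ has stronger curvature growth than $\tilde G$ and $\tilde G$ is not $L^1$-Liouville, then $G$ is not $L^1$-Liouville.
   Context: A graph is a triple $G=(V,b,m)$, where $V$ is the (countable) set of vertices, $b:V\times V\to[0,\infty)$ is symmetric and vanishes on the diagonal, and $m:V\to(0,\infty)$. Write $x\sim y$ if $b(x,y)\neq 0$. All graphs are assumed connected (any two vertices are joined by a finite path $x=x_0\sim x_1\sim\dots\sim x_n=y$) and locally finite ($\{y: b(x,y)\ne 0\}$ is finite for every $x$). $d(x,y)$ is the combinatorial distance (minimal number of edges in a path from $x$ to $y$). The Laplacian is $\Delta f(x)=\frac1{m(x)}\sum_{y\in V}b(x,y)(f(x)-f(y))$ for $f:V\to\mathbb R$ (positive sign convention). $L^1(V,m)$ is the set of functions $u$ on $V$ with $\sum_{x\in V}|u(x)|m(x)<\infty$. A graph is $L^1$-Liouville if every non-negative $u\in L^1(V,m)$ with $\Delta u\ge 0$ on $V$ is constant. For a fixed vertex $x_0$ put $S_r(x_0)=\{y: d(x_0,y)=r\}$. For $x\in S_r(x_0)$ the outer and inner curvatures (with respect to $x_0$) are $k_{\pm}(x)=\frac1{m(x)}\sum_{y\in S_{r\pm1}(x_0)}b(x,y)$. A graph is a model graph with root $o$ if, for every $r\ge 0$, its curvatures with respect to $o$ are constant on $S_r(o)$;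 for a model $\tilde G$ these constants are denoted $\tilde k_\pm(r)$. $G$ has stronger curvature growth than a model $\tilde G$ if there exists a vertex $x_0\in V$ such that $k_+(x)\ge\tilde k_+(r)$ and $k_-(x)\le\tilde k_-(r)$ for all $r\ge0$ and all $x\in S_r(x_0)$ (curvatures of $G$ taken with respect to $x_0$). $G$ has weaker curvature growth than $\tilde G$ if there exists $x_0\in V$ such that the opposite inequalities $k_+(x)\le\tilde k_+(r)$ and $k_-(x)\ge\tilde k_-(r)$ hold for all $r\ge0$ and all $x\in S_r(x_0)$. *)

(* Defs.v *)
From HB Require Import structures.
From mathcomp Require Import all_boot all_order all_algebra.
From mathcomp Require Import all_classical all_reals all_analysis.

Set Implicit Arguments.
Unset Strict Implicit.
Unset Printing Implicit Defensive.

Import Order.TTheory GRing.Theory Num.Theory.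
Local Open Scope classical_set_scope.
Local Open Scope ring_scope.

Record graph (R : realType) := Graph {
  vertex :> countType;
  weight : vertex -> vertex -> R;
  meas : vertex -> R;
  weight_ge0 : forall x y, 0 <= weight x y;
  weight_sym : forall x y, weight x y = weight y x;
  weight_diag : forall x, weight x x = 0;
  meas_gt0 : forall x, 0 < meas x;
  graph_connected : forall x y,
    exists p : seq vertex, path (fun u v => weight u v != 0) x p /\ last x p = y;
  graph_locally_finite : forall x, finite_set [set y | weight x y != 0]
}.

Section GraphDefs.
Context (R : realType) (G : graph R).
Implicit Types (x y : G) (u f : G -> R) (r n : nat).

Definition adj : rel G := fun x y => weight x y != 0.

Definition joined_by x y n : Prop :=
  exists p : seq G, [/\ path adj x p, last x p = y & size p = n].

Lemma joined_ex x y : exists n, `[< joined_by x y n >].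
Proof.
have [p [px py]] := graph_connected x y.
by exists (size p); apply/asboolP; exists p; split.
Qed.

Definition dist x y : nat := ex_minn (joined_ex x y).

Definition sphere x0 r : set G := [set y | dist x0 y = r].

(* Only finitely many terms are nonzero, by local finiteness, so the finitely
   supported sum is the sum over all vertices. *)
Definition laplacian f x : R :=
  (meas x)^-1 * \sum_(y \in [set: G]) (weight x y * (f x - f y)).

Definition in_L1 u : Prop :=
  (\esum_(x in [set: G]) (`|u x| * meas x)%:E < +oo)%E.

Definition L1_Liouville : Prop :=
  forall u, (forall x, 0 <= u x) -> in_L1 u ->
    (forall x, 0 <= laplacian u x) -> exists c : R, forall x, u x = c.

Definition outer_curv x0 x : R :=
  (meas x)^-1 * \sum_(y \in sphere x0 (dist x0 x).+1) weight x y.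

(* The index set is the sphere of radius d(x0, x) - 1, empty when x = x0;
   truncated subtraction would give the sphere of radius 0 there. *)
Definition inner_curv x0 x : R :=
  (meas x)^-1 *
  \sum_(y \in [set y | (dist x0 y).+1 = dist x0 x]) weight x y.

(* G is a model with root o and curvatures kp r, km r on the sphere of radius
   r; the values at the radii of empty spheres are unconstrained. *)
Definition model_graph (o : G) (kp km : nat -> R) : Prop :=
  forall r x, sphere o r x -> outer_curv o x = kp r /\ inner_curv o x = km r.

Definition stronger_curvature (kp km : nat -> R) : Prop :=
  exists x0, forall r x, sphere x0 r x ->
    kp r <= outer_curv x0 x /\ inner_curv x0 x <= km r.

Definition weaker_curvature (kp km : nat -> R) : Prop :=
  exists x0, forall r x, sphere x0 r x ->
    outer_curv x0 x <= kp r /\ km r <= inner_curv x0 x.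

End GraphDefs.

Arguments L1_Liouville {R} G.
Arguments model_graph {R} G o kp km.
Arguments stronger_curvature {R} G kp km.
Arguments weaker_curvature {R} G kp km.

(* Main.v *)
Require Import Defs.
From HB Require Import structures.
From mathcomp Require Import all_boot all_order all_algebra.
From mathcomp Require Import finmap ring lra zify.
From mathcomp Require Import all_classical all_reals all_analysis.

(* Two criteria hold on any graph. If some W with finite sublevel sets satisfies
   Delta W >= -1, then testing a superharmonic u in L^1 against (c - W)^+ and
   letting c tend to infinity shows that u is harmonic; as min(u, t) is again
   such a function, u is constant. If instead some v >= 0 satisfies
   Delta v >= 1, then Green's formula bounds the L^1 norm of the Green function
   of any vertex by a multiple of the value of v there, and the Green function
   is superharmonic and not constant.
   On an infinite model, the solution A of Delta (A o d) = -1 with A(0) = 0 is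
   nondecreasing and depends on the curvatures only. Weaker growth makes
   Delta (A o d) >= -1 on G, stronger growth makes Delta (A o d) <= -1. So
   W = A o d works when A is unbounded and v = sup A - A o d when it is bounded,
   and both criteria apply to the model itself. A finite model has some
   kp r = 0, which forces a graph of weaker growth to be finite. *)

Set Implicit Arguments.
Unset Strict Implicit.
Unset Printing Implicit Defensive.

Import Order.TTheory GRing.Theory Num.Theory.
Import numFieldNormedType.Exports.
Local Open Scope classical_set_scope.
Local Open Scope ring_scope.

(** * The Laplacian as a finite sum, Green's formula, truncation *)

Section Laplacian.
Context (R : realType) (G : graph R).
Implicit Types (x y z : G) (u h f g : G -> R) (r : seq G).

Lemma adj_sym x y : adj x y = adj y x.
Proof. by rewrite /adj weight_sym. Qed.

Definition neighbors x : {fset G} := fset_set [set y | adj x y].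

Lemma mem_neighbors x y : (y \in neighbors x) = adj x y.
Proof.
by rewrite in_fset_set ?mem_setE //; exact: (graph_locally_finite x).
Qed.

(** A neighbor at which [f] takes the value [f x] contributes nothing, so one list [r] can serve all
    vertices at once in Green's formula. *)
Lemma laplacianE f x r : uniq r ->
  (forall y, adj x y -> y \notin r -> f y = f x) ->
  laplacian f x = (meas x)^-1 * \sum_(y <- r) weight x y * (f x - f y).
Proof.
move=> ur hr; rewrite /laplacian; congr (_ * _); rewrite (fsbigE r)//.
  by apply: eq_bigl => y; rewrite in_setT.
move=> y _ yr; have [->|wxy] := eqVneq (weight x y) 0; first by rewrite mul0r.
by rewrite hr ?subrr ?mulr0.
Qed.

Lemma laplacian_neighbors f x : laplacian f x =
  (meas x)^-1 * \sum_(y <- neighbors x) weight x y * (f x - f y).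
Proof.
by apply: laplacianE => [|y]; rewrite ?fset_uniq// -mem_neighbors => ->.
Qed.

Lemma laplacian_cst (c : R) x : laplacian (fun=> c) x = 0.
Proof.
rewrite laplacian_neighbors big1 ?mulr0// => y _.
by rewrite subrr mulr0.
Qed.

Lemma laplacian_cstB (c : R) f x : laplacian (fun y => c - f y) x = - laplacian f x.
Proof.
rewrite !laplacian_neighbors -mulrN -sumrN; congr (_ * _).
by apply: eq_bigr => y _; ring.
Qed.

Lemma ler_laplacian f g x : f x = g x -> (forall y, adj x y -> g y <= f y) ->
  laplacian f x <= laplacian g x.
Proof.
move=> fgx gf; rewrite !laplacian_neighbors; apply: ler_wpM2l.
  by rewrite invr_ge0 ltW ?meas_gt0.
rewrite big_seq [leRHS]big_seq; apply: ler_sum => y; rewrite mem_neighbors => xy.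
by rewrite ler_wpM2l ?weight_ge0// fgx lerB// gf.
Qed.

(** As [h] has finite support, [u] is arbitrary: both sides become double sums over [r], which the
    symmetry of [weight] allows to exchange. *)
Lemma green_formula u h r : uniq r ->
  (forall x, h x != 0 -> x \in r) ->
  (forall x y, h x != 0 -> adj x y -> y \in r) ->
  \sum_(x <- r) u x * (meas x * laplacian h x) =
  \sum_(x <- r) h x * (meas x * laplacian u x).
Proof.
move=> ur hr hadj.
have hout x : x \notin r -> h x = 0 by apply: contraNeq => /hr.
have m0 x : meas x != 0 by rewrite gt_eqF ?meas_gt0.
transitivity (\sum_(x <- r) \sum_(y <- r) weight x y * u x * (h x - h y)).
  rewrite big_seq [RHS]big_seq; apply: eq_bigr => x xr.
  rewrite (@laplacianE _ _ r)//; last first.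
    move=> y xy yr; rewrite hout//; apply/esym/eqP.
    by apply: contraNT yr => hx; exact: hadj hx xy.
  rewrite mulVKf// mulr_sumr; apply: eq_bigr => y _.
  by rewrite mulrCA mulrA.
transitivity (\sum_(x <- r) \sum_(y <- r) weight x y * h x * (u x - u y)).
  under eq_bigr do under eq_bigr do rewrite mulrBr.
  under [RHS]eq_bigr do under eq_bigr do rewrite mulrBr.
  under eq_bigr do rewrite sumrB.
  under [RHS]eq_bigr do rewrite sumrB.
  rewrite !sumrB; congr (_ - _).
    by apply: eq_bigr => x _; apply: eq_bigr => y _; rewrite mulrAC.
  rewrite exchange_big; apply: eq_bigr => x _; apply: eq_bigr => y _.
  by rewrite weight_sym mulrAC.
apply: eq_bigr => x _; have [->|hx] := eqVneq (h x) 0.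
  by rewrite mul0r big1// => y _; rewrite mulr0 mul0r.
rewrite (@laplacianE _ _ r)//; last by move=> y /(hadj _ _ hx) ->.
by rewrite mulVKf// mulr_sumr; apply: eq_bigr => y _; rewrite mulrCA mulrA.
Qed.

Definition neighborhood r : seq G :=
  undup (r ++ flatten [seq (neighbors x : seq G) | x <- r]).

Lemma neighborhood_uniq r : uniq (neighborhood r).
Proof. exact: undup_uniq. Qed.

Lemma sub_neighborhood r : {subset r <= neighborhood r}.
Proof. by move=> x xr; rewrite mem_undup mem_cat xr. Qed.

Lemma adj_neighborhood r x y : x \in r -> adj x y -> y \in neighborhood r.
Proof.
move=> xr xy; rewrite mem_undup mem_cat; apply/orP; right.
by apply/flatten_mapP; exists x; rewrite ?mem_neighbors.
Qed.

Lemma in_L1P u : (forall x, 0 <= u x) ->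
  in_L1 u <->
  exists C, forall r, uniq r -> \sum_(x <- r) u x * meas x <= C.
Proof.
move=> u0; rewrite /in_L1.
under eq_esum do rewrite ger0_norm//.
set S := esum _ _; have S0 : (0 <= S)%E.
  by apply: esum_ge0 => x _; rewrite lee_fin mulr_ge0// ltW// meas_gt0.
split=> [Soo|[C hC]].
  exists (fine S) => r ur; rewrite -lee_fin fineK ?ge0_fin_numE//.
  apply: esum_ge; exists [set` r].
    by split; [exact: finite_seq|].
  by rewrite -fsbig_seq// sumEFin.
apply: (@le_lt_trans _ _ C%:E); last by rewrite ltry.
rewrite /S /esum; apply: ge_ereal_sup => _ /= [X [finX _]] <-.
by rewrite fsbig_finite//= sumEFin lee_fin hC// fset_uniq.
Qed.

Lemma connected_cst f : (forall x y, adj x y -> f y = f x) ->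
  forall x y, f y = f x.
Proof.
move=> fadj x y; have [p [+ <-]] := graph_connected x y.
elim: p x => //= z p IH x /andP[xz zp].
by rewrite IH// (fadj _ _ xz).
Qed.

(** At [x] the minimum touches from below either [u] or the constant [t], both superharmonic
    there. *)
Lemma superharmonic_min u t x : 0 <= laplacian u x ->
  0 <= laplacian (fun y => Num.min (u y) t) x.
Proof.
move=> ux; have [uxt|tux] := leP (u x) t.
  apply: le_trans ux _; apply: ler_laplacian; first by rewrite min_l.
  by move=> y _; rewrite ge_min lexx.
rewrite -(laplacian_cst t x); apply: ler_laplacian; first by rewrite min_r ?ltW.
by move=> y _; rewrite ge_min lexx orbT.
Qed.

(** * Liouville property from an exhaustion function *)

Section Exhaustion.
Context (W : G -> R) (Wfin : forall c, finite_set [set x | W x < c])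
  (Wlap : forall x, -1 <= laplacian W x).

(* Testing [u] against the compactly supported truncation [(c - W)^+], whose
   Laplacian is at most 1, bounds the mass of [u] below by a quantity linear
   in [c]. *)
Lemma exhaustion_harmonic u : (forall x, 0 <= u x) -> in_L1 u ->
  (forall x, 0 <= laplacian u x) -> forall x, laplacian u x = 0.
Proof.
move=> u0 /(in_L1P u0)[C hC] ulap z; apply/eqP; apply: contraT => uz.
have {uz} q0 : 0 < meas z * laplacian u z.
  by rewrite mulr_gt0 ?meas_gt0// lt_neqAle eq_sym uz ulap.
have C0 : 0 <= C by have := hC [::] isT; rewrite big_nil.
(* This [c] makes the term of [z] in Green's formula equal to [C + 1], above the mass bound [C]. *)
set c := W z + (C + 1) / (meas z * laplacian u z).
have hz : 0 < c - W z by rewrite addrAC subrr add0r divr_gt0// ltr_wpDl.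
pose h x := Num.max (c - W x) 0.
pose r := neighborhood (fset_set [set x | W x < c]).
have hsupp x : h x != 0 -> x \in (fset_set [set x | W x < c] : {fset G}).
  move=> hx; rewrite in_fset_set// mem_setE /=.
  by apply: contraNT hx; rewrite -leNgt -subr_le0 => ?; rewrite /h max_r.
have hr x : h x != 0 -> x \in r by move=> /hsupp; exact: sub_neighborhood.
have hadj x y : h x != 0 -> adj x y -> y \in r.
  by move=> /hsupp; exact: adj_neighborhood.
(* [h] lies above [c - W] and above 0, and at [x] it equals one of the two. *)
have hlap x : laplacian h x <= 1.
  have [xc|cx] := ltP (W x) c.
    apply: (@le_trans _ _ (laplacian (fun y => c - W y) x)).
      apply: ler_laplacian; first by rewrite /h max_l// subr_ge0 ltW.
      by move=> y _; rewrite le_max lexx.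
    by rewrite laplacian_cstB lerNl.
  apply: (@le_trans _ _ (laplacian (fun=> 0) x)); last by rewrite laplacian_cst.
  apply: ler_laplacian; first by rewrite /h max_r// subr_le0.
  by move=> y _; rewrite le_max lexx orbT.
have h0 x : 0 <= h x by rewrite le_max lexx orbT.
have zr : z \in r by apply: hr; rewrite /h max_l ?ltW// gt_eqF.
suff : C + 1 <= C by rewrite gerDl ler10.
apply: le_trans (hC r (neighborhood_uniq _)).
apply: (@le_trans _ _ (\sum_(x <- r) u x * (meas x * laplacian h x))); last first.
  apply: ler_sum => x _; rewrite ler_wpM2l// ler_piMr// ltW//; exact: meas_gt0.
rewrite (green_formula _ (neighborhood_uniq _) hr hadj) (bigD1_seq z)//=.
  rewrite {1}/h (max_l (ltW hz)) /c addrAC subrr add0r divfK ?gt_eqF// lerDl.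
  apply: sumr_ge0 => x _; apply: mulr_ge0 => //; apply: mulr_ge0 => //.
  exact/ltW/meas_gt0.
exact: neighborhood_uniq.
Qed.

Lemma exhaustion_Liouville : L1_Liouville G.
Proof.
move=> u u0 uL1 ulap.
have [[z]|noz] := pselect (exists z : G, True); last first.
  by exists 0 => x; case: noz; exists x.
suff uadj x y : adj x y -> u x <= u y.
  exists (u z) => x; apply: connected_cst => a b ab.
  by apply: le_anti; rewrite !uadj// adj_sym.
(* [v] will be harmonic with its maximum [u x] at [x], so it takes this value at the neighbor [y]
   too. *)
move=> xy; pose v y := Num.min (u y) (u x).
have v0 w : 0 <= v w by rewrite le_min !u0.
have vL1 : in_L1 v.
  apply/(in_L1P v0); have [C hC] := (in_L1P u0).1 uL1; exists C => r ur.
  apply: le_trans (hC r ur); apply: ler_sum => w _.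
  apply: ler_wpM2r; first exact/ltW/meas_gt0.
  by rewrite ge_min lexx.
have := exhaustion_harmonic v0 vL1 (fun w => superharmonic_min _ (ulap w)) x.
rewrite laplacian_neighbors => /eqP; rewrite mulf_eq0 invr_eq0 gt_eqF ?meas_gt0//=.
have vx w : 0 <= v x - v w by rewrite /v minxx subr_ge0 ge_min lexx orbT.
rewrite psumr_eq0; last by move=> w _; rewrite mulr_ge0// weight_ge0.
move=> /allP /(_ y); rewrite mem_neighbors => /(_ xy) /=.
rewrite mulf_eq0 (negbTE xy)/= subr_eq0 /v minxx => /eqP ->.
by rewrite ge_min lexx.
Qed.

End Exhaustion.
End Laplacian.

(** * Distance, spheres and the Laplacian of radial functions *)

Section Spheres.
Context (R : realType) (G : graph R).
Implicit Types (o x y : G).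

Lemma dist_path x y :
  exists p, [/\ path (@adj R G) x p, last x p = y & size p = dist x y].
Proof. by rewrite /dist; case: ex_minnP => n /asboolP[p ?] _; exists p. Qed.

Lemma dist_le x y p :
  path (@adj R G) x p -> last x p = y -> (dist x y <= size p)%N.
Proof.
rewrite /dist; case: ex_minnP => n _ nmin xp py.
by apply: nmin; apply/asboolP; exists p.
Qed.

Lemma distxx x : dist x x = 0%N.
Proof. by apply/eqP; rewrite -leqn0 (@dist_le x x [::]). Qed.

Lemma dist_eq0 x y : dist x y = 0%N -> x = y.
Proof. by move=> d0; have [p []] := dist_path x y; rewrite d0; case: p. Qed.

Lemma dist_adj o x y : adj x y -> (dist o y <= (dist o x).+1)%N.
Proof.
move=> xy; have [p [op px <-]] := dist_path o x; rewrite -(size_rcons p y).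
by apply: dist_le; rewrite ?last_rcons// rcons_path op px.
Qed.

Lemma dist_pred o y n : dist o y = n.+1 -> exists2 x, dist o x = n & adj x y.
Proof.
move=> dy; have [p] := dist_path o y; rewrite dy.
case/lastP: p => [|p z] [] //; rewrite rcons_path last_rcons size_rcons.
move=> /andP[op pz] zy [pn]; exists (last o p); last by rewrite -zy.
apply/eqP; rewrite eqn_leq -{1}pn (dist_le op)//= -ltnS -dy.
by apply: dist_adj; rewrite -zy.
Qed.

Lemma sphere_finite o n : finite_set (sphere o n).
Proof.
elim: n => [|n IH].
  by apply: (@sub_finite_set _ _ [set o]) => // y /dist_eq0 /= ->.
apply: (@sub_finite_set _ _ (\bigcup_(x in sphere o n) [set y | weight x y != 0])).
  by move=> y /dist_pred[x xn xy]; exists x.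
by apply: bigcup_finite => // x _; exact: graph_locally_finite.
Qed.

Lemma ball_finite o n : finite_set [set y | (dist o y < n)%N].
Proof.
apply: (@sub_finite_set _ _ (\bigcup_(k in `I_n) sphere o k)).
  by move=> y yn; exists (dist o y).
by apply: bigcup_finite => // k _; exact: sphere_finite.
Qed.

Lemma sphere_eq0 o n m : (n <= m)%N -> sphere o n = set0 -> sphere o m = set0.
Proof.
move=> /subnK <-; elim: (m - n)%N => // k IH /IH; rewrite addSn => n0.
apply/seteqP; split=> // y /dist_pred[x xn _].
by have : sphere o (k + n)%N x by []; rewrite n0.
Qed.

Lemma graph_finite o n : sphere o n = set0 -> finite_set [set: G].
Proof.
move=> n0; apply: sub_finite_set (ball_finite o n) => y _ /=.
rewrite ltnNge; apply/negP => /sphere_eq0 /(_ n0) m0.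
by have : sphere o (dist o y) y by []; rewrite m0.
Qed.

Lemma sum_weight (A : set G) x : \sum_(y \in A) weight x y =
  \sum_(y <- neighbors x) weight x y * (y \in A)%:R.
Proof.
rewrite fsbig_mkcond (fsbigTE (neighbors x)).
  apply: eq_bigr => y _; rewrite /patch; case: ifP; by rewrite ?mulr1 ?mulr0.
move=> y; rewrite mem_neighbors negbK => /eqP xy; rewrite /patch.
by rewrite xy; case: ifP.
Qed.

Lemma inner_curv_ge0 o x : 0 <= inner_curv o x.
Proof.
apply: mulr_ge0; first by rewrite invr_ge0 ltW// meas_gt0.
by rewrite sum_weight; apply: sumr_ge0 => y _; rewrite mulr_ge0 ?weight_ge0.
Qed.

Lemma outer_curv_gt0 o x y :
  adj x y -> dist o y = (dist o x).+1 -> 0 < outer_curv o x.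
Proof.
move=> xy dy; rewrite mulr_gt0 ?invr_gt0 ?meas_gt0// sum_weight.
have yx : y \in (neighbors x : seq G) by rewrite mem_neighbors.
rewrite (bigD1_seq y)//=; last exact: fset_uniq.
apply: ltr_wpDr.
  by apply: sumr_ge0 => z _; rewrite mulr_ge0 ?weight_ge0.
by rewrite mem_set ?mulr1 // lt_neqAle eq_sym weight_ge0 andbT.
Qed.

(** Edges inside a sphere contribute nothing. At [x = o] the truncated [.-1] makes the last
    difference vanish. *)
Lemma laplacian_radial o (f : nat -> R) x :
  laplacian (fun y => f (dist o y)) x =
  outer_curv o x * (f (dist o x) - f (dist o x).+1) +
  inner_curv o x * (f (dist o x) - f (dist o x).-1).
Proof.
rewrite laplacian_neighbors /outer_curv /inner_curv !sum_weight -!mulrA -mulrDr.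
congr (_ * _); rewrite !mulr_suml -big_split /= big_seq [RHS]big_seq.
apply: eq_bigr => y; rewrite mem_neighbors => xy.
rewrite -!mulrA -mulrDr; congr (_ * _).
have yx := dist_adj o xy; have : adj y x by rewrite adj_sym.
move=> /(dist_adj o) {xy}; rewrite leq_eqVlt ltnS leq_eqVlt => xy.
have [dy|ny] := eqVneq (dist o y) (dist o x).+1.
  rewrite dy mem_set// memNset /=; last by move=> /=; rewrite dy; lia.
  by rewrite mul1r mul0r addr0.
rewrite memNset ?mul0r ?add0r; last by apply/eqP.
have [dx|nx] := eqVneq (dist o x) (dist o y).+1.
  by rewrite dx mem_set ?mul1r.
rewrite memNset /= ?mul0r; last by move=> /= /esym/eqP; rewrite (negbTE nx).
have -> : dist o y = dist o x by apply/eqP; lia.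
by rewrite subrr.
Qed.

End Spheres.

(** * The Green function of a vertex, by random walk *)

Section GreenFunction.
Context (R : realType) (G : graph R).
Implicit Types (x y : G) (f u v : G -> R).

Definition degree x : R := \sum_(y <- neighbors x) weight x y.

(** The transition operator of the random walk. *)
Definition mean f x : R :=
  (degree x)^-1 * \sum_(y <- neighbors x) weight x y * f y.

Lemma degree_ge0 x : 0 <= degree x.
Proof. by apply: sumr_ge0 => y _; exact: weight_ge0. Qed.

(** Rules out an isolated vertex, where the inverse in [mean] would take its default value 0. *)
Lemma degree_gt0 f x : laplacian f x != 0 -> 0 < degree x.
Proof.
apply: contraNT; rewrite -leNgt => d0.
have /eqP : degree x = 0 by apply: le_anti; rewrite d0 degree_ge0.
rewrite /degree psumr_eq0 => [/allP w0|y _]; last exact: weight_ge0.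
rewrite laplacian_neighbors big_seq big1 ?mulr0// => y /w0 /eqP ->.
by rewrite mul0r.
Qed.

Lemma laplacian_mean f x : 0 < degree x ->
  meas x * laplacian f x = degree x * (f x - mean f x).
Proof.
move=> d0; rewrite laplacian_neighbors mulVKf ?gt_eqF ?meas_gt0//.
rewrite mulrBr mulVKf ?gt_eqF// mulr_suml -sumrB.
by apply: eq_bigr => y _; rewrite mulrBr.
Qed.

Lemma ler_mean f u x : (forall y, f y <= u y) -> mean f x <= mean u x.
Proof.
move=> fu; apply: ler_wpM2l; first by rewrite invr_ge0 degree_ge0.
by apply: ler_sum => y _; apply: ler_wpM2l; rewrite ?weight_ge0.
Qed.

Lemma mean_ge0 f x : (forall y, 0 <= f y) -> 0 <= mean f x.
Proof.
move=> f0; rewrite mulr_ge0 ?invr_ge0 ?degree_ge0//.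
by apply: sumr_ge0 => y _; rewrite mulr_ge0 ?weight_ge0.
Qed.

Lemma mean_cst (c : R) x : 0 < degree x -> mean (fun=> c) x = c.
Proof. by move=> d0; rewrite /mean -mulr_suml mulKf ?gt_eqF. Qed.

Context (o : G).

(* Expected number of visits to [o], before time [k], of the random walk
   started at [x]. *)
Fixpoint visits k x : R :=
  if k is k'.+1 then (x == o)%:R + mean (visits k') x else 0.

Lemma visits_ge0 k x : 0 <= visits k x.
Proof. by elim: k x => // k IH x; rewrite addr_ge0 ?mean_ge0. Qed.

Lemma visits_leS k x : visits k x <= visits k.+1 x.
Proof.
elim: k x => [|k IH] x; first exact: visits_ge0.
by rewrite [leLHS]/= [leRHS]/= lerD2l ler_mean.
Qed.

(** The walk moves by one edge at each step. Finite support lets Green's formula apply before the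
    limit in [k]. *)
Lemma visits_supp k : exists r : seq G, forall x, visits k x != 0 -> x \in r.
Proof.
elim: k => [|k [r hr]]; first by exists [::] => x; rewrite eqxx.
exists (o :: neighborhood r) => x; rewrite inE; apply: contraNT.
rewrite negb_or /= => /andP[/negbTE -> xr].
rewrite add0r /mean big_seq big1 ?mulr0// => y; rewrite mem_neighbors => xy.
apply/eqP; rewrite mulf_eq0; apply/orP; right; apply: contraNT xr => /hr yr.
by apply: (adj_neighborhood yr); rewrite adj_sym.
Qed.

Section Torsion.
Context (v : G -> R) (v_ge0 : forall x, 0 <= v x)
  (v_lap : forall x, 1 <= laplacian v x).

Let deg_gt0 x : 0 < degree x.
Proof. by apply: (@degree_gt0 v); rewrite gt_eqF// (lt_le_trans ltr01). Qed.

(** Green's formula moves the Laplacian from [v] to [visits k]. Since [visits k <= visits k.+1],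
    this Laplacian times [meas] is nonpositive off [o] and at most [degree o] at [o]. *)
Lemma visits_mass k (s : seq G) : uniq s ->
  \sum_(x <- s) visits k x * meas x <= degree o * v o.
Proof.
move=> us; have [r hr] := visits_supp k.
(* Holds [s], the support of [visits k] with its neighbors, and [o], whose term is split off. *)
pose r' := neighborhood (o :: s ++ r); have ur' := neighborhood_uniq (o :: s ++ r).
have sub x : x \in o :: s ++ r -> x \in r' by exact: sub_neighborhood.
have or' : o \in r' by rewrite sub ?mem_head.
have m0 x : 0 <= visits k x * meas x.
  by rewrite mulr_ge0 ?visits_ge0// ltW ?meas_gt0.
apply: (@le_trans _ _ (\sum_(x <- r') visits k x * meas x)).
  rewrite [leRHS](bigID (mem s))/= -[leLHS]addr0; apply: lerD; last exact: sumr_ge0.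
  rewrite -[leRHS]big_filter le_eqVlt; apply/orP; left; apply/eqP.
  apply: perm_big.
  rewrite uniq_perm ?filter_uniq// => x; rewrite mem_filter.
  by case: (boolP (x \in s)) => //= xs; rewrite sub// inE mem_cat xs orbT.
apply: (@le_trans _ _ (\sum_(x <- r') visits k x * (meas x * laplacian v x))).
  apply: ler_sum => x _; rewrite mulrA ler_peMr//.
rewrite -green_formula//; last 2 first.
- by move=> x /hr xr; rewrite sub// inE mem_cat xr !orbT.
- by move=> x y /hr xr; apply: adj_neighborhood; rewrite inE mem_cat xr !orbT.
rewrite (bigD1_seq o)//= -[leRHS]addr0; apply: lerD; last first.
  apply: sumr_le0 => x xo; rewrite mulr_ge0_le0// laplacian_mean//.
  rewrite mulr_ge0_le0 ?degree_ge0// subr_le0.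
  by have := visits_leS k x; rewrite /= (negbTE xo) add0r.
rewrite mulrC ler_wpM2r// laplacian_mean// ler_piMr ?degree_ge0//.
by rewrite lerBlDr; have := visits_leS k o; rewrite /= eqxx.
Qed.

Lemma visits_homo x : {homo visits^~ x : m n / (m <= n)%N >-> m <= n}.
Proof. by apply: homo_leq => // [|k]; [exact: le_trans|exact: visits_leS]. Qed.

Lemma visits_cvg x : cvgn (visits^~ x).
Proof.
apply: nondecreasing_is_cvgn; first exact: visits_homo.
exists (degree o * v o / meas x) => _ [k _ <-].
have := @visits_mass k [:: x] isT; rewrite big_seq1.
by rewrite ler_pdivlMr ?meas_gt0.
Qed.

Definition green x : R := limn (visits^~ x).

(** Serves with [c] equal to [meas] for the mass and to [weight x] for the mean. *)
Lemma cvg_sum_visits (c : G -> R) (r : seq G) :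
  (fun k => \sum_(x <- r) c x * visits k x) @ \oo -->
  \sum_(x <- r) c x * green x.
Proof.
apply: cvg_big => [|x _]; first exact: add_continuous.
by apply: cvgMr; exact: visits_cvg.
Qed.

Lemma visits_le_green k x : visits k x <= green x.
Proof. by apply: nondecreasing_cvgn_le; [exact: visits_homo|exact: visits_cvg]. Qed.

Lemma green_ge0 x : 0 <= green x.
Proof. exact: visits_le_green 0%N x. Qed.

Lemma green_L1 : in_L1 green.
Proof.
apply/(in_L1P green_ge0); exists (degree o * v o) => r ur.
under eq_bigr do rewrite mulrC.
apply: (cvgr_to_le (@cvg_sum_visits (@meas R G) r)); apply: nearW => k.
by under eq_bigr do rewrite mulrC; exact: visits_mass.
Qed.

(** The recursion for [visits], in the limit. *)
Lemma green_mean x : (x == o)%:R + mean green x <= green x.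
Proof.
rewrite -lerBrDl /mean mulrC -ler_pdivlMr ?invr_gt0//.
apply: (cvgr_to_le (@cvg_sum_visits (weight x) (neighbors x))); apply: nearW => k.
by rewrite ler_pdivlMr ?invr_gt0// lerBrDl mulrC (visits_le_green k.+1).
Qed.

Lemma green_superharmonic x : 0 <= laplacian green x.
Proof.
rewrite -(pmulr_rge0 _ (meas_gt0 x)) laplacian_mean// mulr_ge0 ?degree_ge0//.
by rewrite subr_ge0; apply: le_trans (green_mean x); rewrite lerDr.
Qed.

Lemma torsion_not_Liouville : ~ L1_Liouville G.
Proof.
move=> /(_ green green_ge0 green_L1 green_superharmonic)[c hc].
(* For a constant [c] this reads [1 + c <= c]. *)
have := green_mean o; rewrite eqxx (_ : green = fun=> c); last exact/funext.
by rewrite mean_cst// gerDr ler10.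
Qed.

End Torsion.
End GreenFunction.

Lemma finite_Liouville (R : realType) (G : graph R) :
  finite_set [set: G] -> L1_Liouville G.
Proof.
move=> Gfin; apply: (@exhaustion_Liouville _ _ (fun=> 0)) => [c|x].
  exact: sub_finite_set Gfin.
by rewrite laplacian_cst lerN10.
Qed.

(** * Comparison through the radial solution *)

Section Comparison.
Context (R : realType) (kp km : nat -> R).
Context (kp_gt0 : forall r, 0 < kp r) (km_ge0 : forall r, 0 <= km r).
Implicit Types (G : graph R) (r n : nat).

(* On a model, [crossing r] is the ratio of the measure of the ball of radius
   [r] to the weight of the edges leaving it: the expected time that the walk
   started on the sphere of radius [r] takes to reach the next sphere. *)
Fixpoint crossing r : R :=
  (1 + if r is r'.+1 then km r * crossing r' else 0) / kp r.

(** This is the solution [A]: on an infinite model, the expected time for the walk from the root to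
    reach radius [n]. *)
Definition exit_time n : R := \sum_(r < n) crossing r.

Lemma crossing_ge0 r : 0 <= crossing r.
Proof.
elim: r => [|r IH] /=; apply: divr_ge0; rewrite ?(ltW (kp_gt0 _))// ?addr0//.
by rewrite addr_ge0// mulr_ge0.
Qed.

Lemma exit_timeS n : exit_time n.+1 = exit_time n + crossing n.
Proof. exact: big_ord_recr. Qed.

Lemma exit_time_homo : {homo exit_time : m n / (m <= n)%N >-> m <= n}.
Proof.
apply: homo_leq => // [|n]; first exact: le_trans.
by rewrite exit_timeS lerDl crossing_ge0.
Qed.

(** The radial form of [Delta (A o d) = -1]; as [0.-1 = 0], the inner term vanishes at the root. *)
Lemma exit_time_rec r : kp r * (exit_time r.+1 - exit_time r) =
  1 + km r * (exit_time r - exit_time r.-1).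
Proof.
rewrite exit_timeS addrAC subrr add0r; case: r => [|r] /=.
  by rewrite subrr mulr0 !addr0 mulrC divfK ?gt_eqF.
by rewrite exit_timeS addrAC subrr add0r mulrC divfK ?gt_eqF.
Qed.

Lemma weaker_Liouville G : weaker_curvature G kp km ->
  (forall c, exists n, c <= exit_time n) -> L1_Liouville G.
Proof.
move=> [x0 curv] unbd.
apply: (@exhaustion_Liouville _ _ (fun x => exit_time (dist x0 x))) => [c|x].
  (* By monotonicity, [c <= exit_time n] confines the sublevel set to a ball. *)
  have [n cn] := unbd c; apply: sub_finite_set (ball_finite x0 n) => x /= xc.
  by rewrite ltnNge; apply: contraTN xc => /exit_time_homo /(le_trans cn);
     rewrite leNgt.
have [kpx kmx] := curv _ x erefl.
rewrite laplacian_radial; set r := dist x0 x in kpx kmx *.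
(* As both increments are nonnegative, a smaller outer and a larger inner curvature can only raise
   the Laplacian from -1. *)
have d1 : 0 <= exit_time r.+1 - exit_time r by rewrite subr_ge0 exit_time_homo.
have d2 : 0 <= exit_time r - exit_time r.-1.
  by rewrite subr_ge0 exit_time_homo// leq_pred.
have := exit_time_rec r.
have := ler_wpM2r d1 kpx; have := ler_wpM2r d2 kmx; lra.
Qed.

Lemma stronger_not_Liouville G S : stronger_curvature G kp km ->
  (forall n, exit_time n <= S) -> ~ L1_Liouville G.
Proof.
move=> [x0 curv] bd.
apply: (@torsion_not_Liouville _ _ x0 (fun x => S - exit_time (dist x0 x))) => x.
  by rewrite subr_ge0.
have [kpx kmx] := curv _ x erefl.
rewrite laplacian_cstB laplacian_radial; set r := dist x0 x in kpx kmx *.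
have d1 : 0 <= exit_time r.+1 - exit_time r by rewrite subr_ge0 exit_time_homo.
have d2 : 0 <= exit_time r - exit_time r.-1.
  by rewrite subr_ge0 exit_time_homo// leq_pred.
have := exit_time_rec r.
have := ler_wpM2r d1 kpx; have := ler_wpM2r d2 kmx; lra.
Qed.

End Comparison.

(** * Curvatures of a model, and the finite case *)

Section Model.
Context (R : realType) (Gt : graph R) (o : Gt) (kp km : nat -> R)
  (hmodel : model_graph Gt o kp km).

Lemma model_weaker : weaker_curvature Gt kp km.
Proof. by exists o => r x /hmodel[-> ->]. Qed.

Lemma model_stronger : stronger_curvature Gt kp km.
Proof. by exists o => r x /hmodel[-> ->]. Qed.

Lemma model_outer_gt0 r : sphere o r.+1 !=set0 -> 0 < kp r.
Proof.
move=> [y yr]; have [x xr xy] := dist_pred yr.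
have [<- _] := hmodel xr; apply: outer_curv_gt0 xy _.
by rewrite yr xr.
Qed.

Lemma model_inner_ge0 r : sphere o r !=set0 -> 0 <= km r.
Proof. by move=> [x /hmodel[_ <-]]; exact: inner_curv_ge0. Qed.

Lemma weaker_finite (G : graph R) n : sphere o n = set0 ->
  weaker_curvature G kp km -> finite_set [set: G].
Proof.
move=> n0 [x0 curv].
have ex : exists n, `[< sphere o n = set0 >] by exists n; apply/asboolP.
(* At the least empty radius [r.+1], the model sphere of radius [r] is nonempty with no outward
   edge. Hence [kp r = 0], and [G] has no edge from radius [r] outward either. *)
case: (ex_minnP ex) => [[|r] /asboolP r0 rmin].
  by have : sphere o 0 o := distxx o; rewrite r0.
have [x xr] : sphere o r !=set0.
  by apply/set0P/eqP => /asboolP/rmin; rewrite ltnn.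
apply: (@graph_finite _ _ x0 r.+1); apply/seteqP; split=> // y yr.
have [z zr zy] := dist_pred yr.
have : 0 < outer_curv x0 z by apply: outer_curv_gt0 zy _; rewrite yr zr.
rewrite ltNge => /negP; apply; have [+ _] := curv _ _ zr.
have [<- _] := hmodel xr; rewrite {2}/outer_curv xr r0 fsbig_set0 mulr0.
exact.
Qed.

End Model.

Theorem theorem4p6 (R : realType) (Gt : graph R) (o : Gt) (kp km : nat -> R)
    (hmodel : model_graph Gt o kp km) (G : graph R) :
  (weaker_curvature G kp km -> L1_Liouville Gt -> L1_Liouville G) /\
  (stronger_curvature G kp km -> ~ L1_Liouville Gt -> ~ L1_Liouville G).
Proof.
have [[n n0]|/forallNP nonempty] := pselect (exists n, sphere o n = set0).
  (* The model has weaker growth than itself, so it is finite and Liouville, and the second claim is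
     vacuous. *)
  have Gtfin := weaker_finite hmodel n0 (model_weaker hmodel).
  split=> [/(weaker_finite hmodel n0)/finite_Liouville//|_].
  by case; exact: finite_Liouville.
have kp0 r : 0 < kp r by apply: (model_outer_gt0 hmodel); apply/set0P/eqP.
have km0 r : 0 <= km r by apply: (model_inner_ge0 hmodel); apply/set0P/eqP.
(* If [exit_time] is bounded, the model is not Liouville and the first claim is vacuous; if
   unbounded, the second is. *)
have [[S bd]|unbd] := pselect (exists S, forall n, exit_time kp km n <= S).
  have Gt_not := stronger_not_Liouville kp0 km0 (model_stronger hmodel) bd.
  by split=> // /stronger_not_Liouville-/(_ kp0 km0 _ bd).
have {}unbd c : exists n, c <= exit_time kp km n.
  apply: contrapT => /forallNP nc; apply: unbd; exists c => n.
  by rewrite leNgt; apply/negP => /ltW; exact: nc.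
have Gt_Liouville := weaker_Liouville kp0 km0 (model_weaker hmodel) unbd.
by split=> // /weaker_Liouville-/(_ kp0 km0 unbd).
Qed.
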